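(* There are an absolute constant $c_0>0$ and, for each integer $d\geq 1$, a constant $C_d>0$ depending only on $d$, such that for every real $k\geq 1$ the following holds. Let $G$ be a group and suppose $A\subseteq G$ is $d$-NIP with $k$-tripling. Then $A^{\pm 2}\subseteq EA\cap AF$ for some $E,F\subseteq A^{\pm 3}$ with $|E|,|F|\leq C_dk^{c_0}$. In particular, $A^{\pm 1}$ is a $K$-approximate group for some $K\leq C_dk^{c_0}$.
   Context: For $A\subseteq G$ and $n\geq 1$, $A^{\pm n}=(A\cup A^{-1})^n\cup\{1\}$, where $X^n$ denotes the $n$-fold product set. A nonempty set $A\subseteq G$ has $k$-tripling if $A$ is finite and $|A^3|\leq k|A|$. A set $A\subseteq G$ is $d$-NIP if there do not exist $x_1,\dots,x_d\in G$ and $(y_\sigma)_{\sigma\subseteq\{1,\dots,d\}}$ in $G$ such that for all $i,\sigma$: $y_\sigma x_i\in A$ if and only if $i\in\sigma$ (equivalently, the family of left translates of $A$ has VC-dimension $<d$). A set $B\subseteq G$ is a $K$-approximate group if $1\in B$, $B=B^{-1}$, and $B^2$ can be covered by $K$ left translates of $B$. *)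

(* Defs.v *)
From HB Require Import structures.
From mathcomp Require Import all_boot all_order all_algebra.
From mathcomp Require Import finmap.
From mathcomp Require Import all_classical reals exp.

Set Implicit Arguments.
Unset Strict Implicit.
Unset Printing Implicit Defensive.

Import Order.TTheory GRing.Theory Num.Theory.

Local Open Scope group_scope.
Local Open Scope classical_set_scope.

Definition setmul (G : groupType) (X Y : set G) : set G :=
  [set (x * y)%g | x in X & y in Y].

Definition setinv (G : groupType) (X : set G) : set G :=
  [set x^-1%g | x in X].

Definition setexp (G : groupType) (X : set G) (n : nat) : set G :=
  iterop n (@setmul G) X [set 1%g].

(* A^{+-n} *)
Definition setpm (G : groupType) (A : set G) (n : nat) : set G :=
  setexp (A `|` setinv A) n `|` [set 1%g].

(* [fset_set X] is the empty set when [X] is infinite, so every use of [set_card]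
   below comes with a finiteness hypothesis. *)
Definition set_card (T : choiceType) (X : set T) : nat := #|` fset_set X|.

(* Finiteness of [setexp A 3] follows from that of [A]. *)
Definition has_tripling (R : realType) (G : groupType) (k : R) (A : set G) :
    Prop :=
  [/\ A !=set0, finite_set A &
    ((set_card (setexp A 3))%:R <= k * (set_card A)%:R)%R].

Definition NIP (G : groupType) (d : nat) (A : set G) : Prop :=
  ~ exists (x : 'I_d -> G) (y : {set 'I_d} -> G),
      forall (i : 'I_d) (s : {set 'I_d}), A (y s * x i)%g <-> i \in s.

Definition approximate_group (G : groupType) (K : nat) (B : set G) : Prop :=
  [/\ B 1%g, B = setinv B &
    exists g : 'I_K -> G,
      setexp B 2 `<=` \bigcup_(i in [set: 'I_K]) setmul [set g i] B].

(* Main.v *)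
(** By Ruzsa's triangle inequality, small tripling gives
    [|(A U A^-1)^3| <= 8 k^3 |A|].  Hence for [g] in [A^{+-2}] the sets [g A^-1]
    and [A^-1 g] have density at least [1 / (8 k^3)] in [(A U A^-1)^3], and being
    [d]-NIP bounds the VC-dimension of both families.  The epsilon-net theorem
    then provides a set of size [O_d(k^9)] which meets all the [g A^-1]; this is
    exactly an [E] with [A^{+-2}] contained in [E A], and similarly for [F]. *)
Require Import Defs.
From HB Require Import structures.
From mathcomp Require Import all_boot all_order all_algebra.
From mathcomp Require Import finmap.
From mathcomp Require Import all_classical reals exp.
From mathcomp Require Import zify ring lra.

Set Implicit Arguments.
Unset Strict Implicit.
Unset Printing Implicit Defensive.

Import Order.TTheory GRing.Theory Num.Theory.

(** * Shattering and the Sauer-Shelah bound *)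

Section SauerShelah.

Import mathcomp.boot.fintype mathcomp.boot.finset.

Definition shatters (T : finType) (F : {set {set T}}) (s : {set T}) : bool :=
  [forall t : {set T}, (t \subset s) ==> [exists A in F, A :&: s == t]].

Lemma shattersP (T : finType) (F : {set {set T}}) (s : {set T}) :
  reflect (forall t : {set T}, t \subset s -> exists2 A, A \in F & A :&: s = t)
          (shatters F s).
Proof.
apply: (iffP forallP) => [sh t ts|sh t].
  have /implyP/(_ ts)/exists_inP[A AF /eqP At] := sh t.
  by exists A.
apply/implyP => /sh[A AF At]; apply/exists_inP; exists A => //.
by rewrite At.
Qed.

Lemma shattersS (T : finType) (F1 F2 : {set {set T}}) (s : {set T}) :
  F1 \subset F2 -> shatters F1 s -> shatters F2 s.
Proof.
move=> F12 /shattersP sh; apply/shattersP => t /sh[A AF At].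
by exists A => //; apply: (subsetP F12).
Qed.

(* Pajor's form of the Sauer-Shelah lemma. *)
Lemma card_le_shattered (T : finType) (F : {set {set T}}) :
  #|F| <= #|[set s | shatters F s]|.
Proof.
have [n] := ubnP #|F|; elim: n F => // n IHn F; rewrite ltnS => Fn.
have [F1|] := leqP #|F| 1.
  have [->|[A AF]] := set_0Vmem F; first by rewrite cards0.
  apply: leq_trans F1 _; rewrite card_gt0; apply/set0Pn; exists set0.
  rewrite inE; apply/shattersP => t; rewrite subset0 => /eqP ->.
  by exists A => //; rewrite setI0.
case/card_gt1P=> A [B] [AF BF AB].
have [x xAB] : exists x, (x \in A) != (x \in B).
  apply/existsP; apply: contraNT AB; rewrite negb_exists => /forallP h.
  by apply/eqP/setP => x; apply/eqP; move: (h x); rewrite negbK.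
(* [A] and [B] differ at [x], so they fall into different halves: both halves are nonempty, hence
   smaller than [F], and the induction applies to each. *)
pose F0 := [set C in F | x \notin C]; pose F1 := [set C in F | x \in C].
have F0F : F0 \subset F by apply/subsetP => C; rewrite inE => /andP[].
have F1F : F1 \subset F by apply/subsetP => C; rewrite inE => /andP[].
have F01 : #|F| = #|F0| + #|F1|.
  rewrite addnC -(cardsID [set C : {set T} | x \in C] F); congr (_ + _).
    by apply: eq_card => C; rewrite !inE andbC.
  by apply: eq_card => C; rewrite !inE andbC.
have F0gt : 0 < #|F0|.
  rewrite card_gt0; apply/set0Pn; case xA: (x \in A) xAB => xB.
    by exists B; rewrite inE BF; case: (x \in B) xB.
  by exists A; rewrite inE AF xA.
have F1gt : 0 < #|F1|.
  rewrite card_gt0; apply/set0Pn; case xA: (x \in A) xAB => xB.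
    by exists A; rewrite inE AF xA.
  by exists B; rewrite inE BF; case: (x \in B) xB.
pose sh0 := [set s | shatters F0 s]; pose sh1 := [set s | shatters F1 s].
have xsh0 s : shatters F0 s -> x \notin s.
  move=> /shattersP/(_ s (subxx _))[C]; rewrite inE => /andP[_ xC] <-.
  by rewrite inE (negPf xC).
have xsh1 s : shatters F1 s -> x \notin s.
  move=> /shattersP/(_ set0 (sub0set _))[C]; rewrite inE => /andP[_ xC] /setP.
  by move=> /(_ x); rewrite !inE xC /= => ->.
(* A trace on [x |: s] that contains [x] is cut out by a member of [F1], any other by a member of
   [F0]. *)
have shI s : s \in sh0 :&: sh1 -> shatters F (x |: s).
  rewrite !inE => /andP[s0 s1]; apply/shattersP => t txs.
  have tx : t :\ x \subset s by rewrite subDset.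
  have [xt|xt] := boolP (x \in t).
    have [C] := shattersP _ _ s1 _ tx; rewrite inE => /andP[CF xC] Ct.
    by exists C => //; rewrite setIUr Ct (setIidPr _) ?sub1set // setD1K.
  have [C] := shattersP _ _ s0 _ tx; rewrite inE => /andP[CF xC] Ct.
  exists C => //; rewrite setIUr Ct; apply/setP => z; rewrite !inE.
  have [->|_] := eqVneq z x; first by rewrite (negPf xC) (negPf xt).
  by rewrite andbF.
rewrite F01; apply: (@leq_trans (#|sh0| + #|sh1|)).
  by apply: leq_add; apply: IHn; lia.
(* Sets shattered by both halves are counted twice. Their second copy becomes [x |: s], which [F]
   also shatters; it is new, because no set shattered by a half contains [x]. *)
rewrite -cardsUI.
rewrite -(@card_in_imset _ _ (fun s => x |: s) (sh0 :&: sh1)); last first.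
  move=> s t; rewrite !inE => /andP[/xsh0 xs _] /andP[/xsh0 xt _] st.
  by rewrite -(setU1K xs) st setU1K.
rewrite -cardsUI [X in _ + X]eq_card0 ?addn0; last first.
  move=> s; rewrite !inE; apply/negP => /andP[sh /imsetP[t _ st]].
  have /negP[] : x \notin s by case/orP: sh => [/xsh0|/xsh1].
  by rewrite st !inE eqxx.
apply: subset_leq_card; apply/subsetP => s; rewrite in_setU => /orP[|].
  by rewrite !inE => /orP[]; exact: shattersS.
by case/imsetP => t /shI sh ->; rewrite inE.
Qed.

(** A set of at most [d] elements is listed by a map from ['I_d] to [option T], padded with [None];
    hence the base [#|T|.+1]. *)
Lemma card_small_sets (T : finType) (d : nat) :
  #|[set s : {set T} | #|s| <= d]| <= #|T|.+1 ^ d.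
Proof.
pose f (g : {ffun 'I_d -> option T}) : {set T} :=
  [set x | [exists i, g i == Some x]].
rewrite -card_option -[in X in _ ^ X](card_ord d) -card_ffun.
apply: leq_trans (leq_imset_card f _); apply: subset_leq_card.
apply/subsetP => s; rewrite inE => sd.
apply/imsetP; exists [ffun i : 'I_d => onth (enum s) i] => //.
apply/setP => x; rewrite inE -mem_enum; apply/idP/existsP => [xs|[i]].
  have id : index x (enum s) < d.
    by apply: leq_trans sd; rewrite cardE index_mem.
  exists (Ordinal id); rewrite ffunE /=.
  by rewrite onthE (nth_map x) ?index_mem // nth_index.
by rewrite ffunE => /eqP xi; apply/onthP; exists i.
Qed.

Lemma exists_shattered (T : finType) (F : {set {set T}}) (d : nat) :
  #|T|.+1 ^ d < #|F| -> exists2 s : {set T}, shatters F s & d < #|s|.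
Proof.
move=> dF.
have /subsetPn[s] :
    ~~ ([set s | shatters F s] \subset [set s : {set T} | #|s| <= d]).
  apply: contraL dF => /subset_leq_card sub; rewrite -leqNgt.
  by apply: leq_trans (card_le_shattered F) (leq_trans sub _); apply: card_small_sets.
by rewrite !inE -ltnNge => sh ds; exists s.
Qed.

End SauerShelah.

(** * The epsilon-net theorem, by counting samples *)

Section EpsilonNet.

Import mathcomp.boot.fintype mathcomp.boot.finset.

Lemma leq_exp2rW (m n e : nat) : m <= n -> m ^ e <= n ^ e.
Proof. by case: e => // e; rewrite leq_exp2r. Qed.

(** With [L = c * K], a sample of [L] blocks of length [2 * L * K] has [2 * L ^ 2 * K] positions.
    The inequality puts its [2 ^ L] traces above the Sauer-Shelah bound. *)
Lemma net_exponent (d : nat) :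
  exists c, forall K, 0 < K -> (2 * (c * K) ^ 2 * K).+1 ^ d < 2 ^ (c * K).
Proof.
(* The base will be at most [2 ^ (8 * g * K)]; the factor [d.+1] in the constant then beats the
   power [d]. *)
pose g := d + 3; exists (d.+1 * (8 * g)) => K K0.
have lt2 n : n <= 2 ^ n by apply/ltnW/ltn_expl.
have bound : (2 * (d.+1 * (8 * g) * K) ^ 2 * K).+1 <= 2 ^ (8 * g * K).
  apply: (@leq_trans (2 ^ (8 + g * 4 + K * 3))); last first.
    by rewrite leq_exp2l // /g; nia.
  rewrite !expnD !expnM.
  apply: (@leq_trans (2 ^ 8 * g ^ 4 * K ^ 3)); last first.
    by rewrite !leq_mul // leq_exp2r.
  have dg : d.+1 ^ 2 <= g ^ 2 by rewrite leq_exp2r // /g; lia.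
  apply: (@leq_trans (192 * (d.+1 ^ 2) * (g ^ 2) * K ^ 3)); last first.
    rewrite -[g ^ 4]/(g ^ (2 + 2)) expnD leq_mul // mulnA.
    by rewrite leq_mul // leq_mul.
  have : 0 < d.+1 ^ 2 * g ^ 2 * K ^ 3 by rewrite !muln_gt0 ?expn_gt0 K0 /g addnS.
  move: (d.+1) => d1; rewrite -[K ^ 3]/(K * (K * K)) -!mulnn; lia.
apply: (leq_ltn_trans (leq_exp2rW d bound)).
rewrite -expnM ltn_exp2l // -[d.+1 * _ * K]mulnA mulSn [_ * d]mulnC.
by rewrite -[ltnLHS]add0n ltn_add2r !muln_gt0 K0 /g addnS.
Qed.

(** This is [(1 - 1/(k+1))^(k+1) <= 1/2]. It follows from Bernoulli's inequality
    [(1 + 1/k)^n >= 1 + n/k] at [n = k + 1], cleared of denominators; [k = 0] is separate because a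
    factor [k] gets cancelled. *)
Lemma double_expn_pred (k : nat) : 2 * k ^ k.+1 <= k.+1 ^ k.+1.
Proof.
have bernoulli n : k ^ n * (k + n) <= k.+1 ^ n * k.
  elim: n => [|n IHn]; first by rewrite addn0 !expn0.
  rewrite !expnS -mulnA -mulnA.
  apply: leq_trans (leq_mul (leqnn k.+1) IHn).
  by rewrite [k.+1 * (_ * _)]mulnCA [k * (_ * _)]mulnCA leq_mul //; nia.
case: k bernoulli => [|k] bernoulli; first by [].
rewrite -(leq_pmul2r (ltn0Sn k)); apply: leq_trans (bernoulli _).
by rewrite [2 * _]mulnC -mulnA leq_mul //; lia.
Qed.

Definition update (J : finType) (W : Type) (X : {ffun J -> W}) (j : J) (w : W) :
    {ffun J -> W} :=
  [ffun i => if i == j then w else X i].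

Lemma updateK (J : finType) (W : Type) (X : {ffun J -> W}) (j : J) (w : W) :
  update (update X j w) j (X j) = X.
Proof. by apply/ffunP => i; rewrite !ffunE; case: eqP => // ->. Qed.

(* Exchanging [w] and [X j] is an involution of the pairs [(X, w)] under which
   "[X j] is in [D X]" becomes "[w] is in [D X]". *)
Lemma card_coord_mem (J W : finType) (j : J) (D : {ffun J -> W} -> {set W})
    (a : nat) :
  (forall X w, D (update X j w) = D X) ->
  (forall X, #|D X| * a <= #|W|) ->
  #|[set X : {ffun J -> W} | X j \in D X]| * a <= #|{: {ffun J -> W}}|.
Proof.
move=> Dj Da.
have [W0|W0] := posnP #|W|.
  rewrite (_ : [set X : {ffun J -> W} | _] = set0) ?cards0 //; apply/setP => X; rewrite !inE.
  by have /card0_eq/(_ (X j)) := W0; rewrite inE.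
rewrite -(leq_pmul2r W0).
pose s (p : {ffun J -> W} * W) := (update p.1 j p.2, p.1 j).
have sK : involutive s.
  by case=> X w; rewrite /s /= updateK /update ffunE eqxx.
pose P := [set p : {ffun J -> W} * W | p.1 j \in D p.1].
pose P' := [set p : {ffun J -> W} * W | p.2 \in D p.1].
have PP' : #|P| = #|P'|.
  rewrite -(card_preimset P' (can_inj sK)); apply: eq_card => p.
  by rewrite !inE /= Dj.
have cP : #|P| = #|[set X : {ffun J -> W} | X j \in D X]| * #|W|.
  rewrite -[#|W|]cardsT -cardsX; apply: eq_card => -[X w].
  by rewrite !inE andbT.
have cP' : #|P'| = \sum_X #|D X|.
  rewrite -sum1_card.
  under [RHS]eq_bigr do rewrite -sum1_card.
  rewrite pair_big_dep /=; apply: eq_bigl => -[X w] /=.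
  by rewrite !inE.
rewrite mulnAC -cP PP' cP' big_distrl /=.
by apply: leq_trans (leq_sum _ (fun X _ => Da X)) _; rewrite sum_nat_const.
Qed.

(** Each uniform point misses [S] with probability at most [1 - 1/(k+1)], and every [k.+1]
    independent points at least halve the probability of missing it altogether. *)
Lemma card_missing_ffun (V : finType) (S : {set V}) (k L : nat) :
  #|V| <= k.+1 * #|S| ->
  #|[set w : {ffun 'I_(2 * L * k.+1) -> V} | [forall i, w i \notin S]]| *
    2 ^ (2 * L) <= #|{: {ffun 'I_(2 * L * k.+1) -> V}}|.
Proof.
move=> VS; set m := _ * k.+1.
have -> : #|[set w : {ffun 'I_m -> V} | [forall i, w i \notin S]]| = #|~: S| ^ m.
  rewrite -[m in RHS]card_ord -card_ffun_on; apply: eq_card => w; rewrite inE.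
  by apply: eq_forallb => i; rewrite inE.
rewrite card_ffun card_ord.
have Km : 0 < k.+1 ^ m by rewrite expn_gt0.
rewrite -(leq_pmul2l Km) mulnA -expnMn.
apply: (@leq_trans ((k * #|V|) ^ m * 2 ^ (2 * L))).
  rewrite leq_mul //; apply: leq_exp2rW.
  by have := cardsC S; nia.
rewrite expnMn mulnAC leq_mul // /m; move: (2 * L) => p.
rewrite [p * k.+1]mulnC !expnM. rewrite -!expnMn.
by apply: leq_exp2rW; rewrite mulnC double_expn_pred.
Qed.

(* [h] picks a witness that [Z] is not a net.  In a random sample of [L] blocks,
   given the blocks in [t], the witness for their union misses some other block
   with probability at most [2 ^ (- 2 L)]; a union bound over [t] and the block
   concludes. *)
Lemma exists_block_sample (V : finType) (Q : Type) (r : V -> Q -> bool)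
    (h : {set V} -> Q) (k L : nat) :
  0 < #|V| ->
  (forall Z, #|V| <= k.+1 * #|[set v | r v (h Z)]|) ->
  (forall Z : {set V}, #|Z| <= L * (2 * L * k.+1) ->
    forall v, v \in Z -> ~~ r v (h Z)) ->
  exists (X : 'I_L -> 'I_(2 * L * k.+1) -> V) (f : {set 'I_L} -> Q),
    (forall t, exists Z, f t = h Z) /\
    forall (t : {set 'I_L}) j, (j \in t) = [forall i, ~~ r (X j i) (f t)].
Proof.
move=> V0 hbig hmiss; set m := 2 * L * k.+1 in hmiss *.
pose W := {ffun 'I_m -> V}.
pose Z (X : {ffun 'I_L -> W}) (t : {set 'I_L}) : {set V} :=
  [set X p.1 p.2 | p in [set p : 'I_L * 'I_m | p.1 \in t]].
have ZL X t : #|Z X t| <= L * m.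
  apply: leq_trans (leq_imset_card _ _) _; apply: leq_trans (max_card _) _.
  by rewrite card_prod !card_ord.
(* For [u = (t, j)] with [j] outside [t]: block [j] misses the set of the witness for [t], so it
   cannot be told apart from the blocks in [t]. *)
pose bad (u : {set 'I_L} * 'I_L) : {set {ffun 'I_L -> W}} :=
  [set X : {ffun 'I_L -> W} |
    X u.2 \in [set w : W | [forall i, w i \notin [set v | r v (h (Z X u.1))]]]].
have badP (u : {set 'I_L} * 'I_L) : u.2 \notin u.1 ->
    #|bad u| * 2 ^ (2 * L) <= #|{: {ffun 'I_L -> W}}|.
  move=> uN; apply: (card_coord_mem (D := fun X => [set w : W |
    [forall i, w i \notin [set v | r v (h (Z X u.1))]]])) => [X w|X].
    (* Independence: resampling a block outside [t] does not change the witness for [t]. *)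
    suff -> : Z (update X u.2 w) u.1 = Z X u.1 by [].
    apply: eq_in_imset => p; rewrite inE ffunE.
    by case: eqP => // -> pu; rewrite pu in uN.
  exact: card_missing_ffun.
have [X XP] : exists X, X \notin \bigcup_(u : {set 'I_L} * 'I_L | u.2 \notin u.1) bad u.
  apply/existsP; rewrite -negb_forall; apply/negP => /forallP all_bad.
  (* There are at most [2 ^ L * L] bad events; if they covered all samples, then [2 ^ L <= L]. *)
  have : #|{: {ffun 'I_L -> W}}| * 2 ^ (2 * L) <=
         2 ^ L * L * #|{: {ffun 'I_L -> W}}|.
    apply: (@leq_trans (\sum_(u : {set 'I_L} * 'I_L | u.2 \notin u.1) #|bad u| * 2 ^ (2 * L))).
      rewrite -big_distrl leq_mul //=.
      apply: (@leq_trans #|\bigcup_(u : {set 'I_L} * 'I_L | u.2 \notin u.1) bad u|).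
        by apply/subset_leq_card/fintype.subsetP => X _; apply: all_bad.
      apply: (big_ind2 (fun (B : {set {ffun 'I_L -> W}}) n => #|B| <= n)) => //.
        by rewrite cards0.
      move=> B n B' n' Bn B'n'; apply: leq_trans (leq_add Bn B'n').
      by rewrite -cardsUI leq_addr.
    apply: leq_trans (leq_sum _ badP) _.
    rewrite sum_nat_const leq_mul //; apply: leq_trans (max_card _) _.
    by rewrite card_prod -cardsT -powersetT card_powerset cardsT !card_ord.
  have X0 : 0 < #|{: {ffun 'I_L -> W}}| by rewrite !card_ffun !expn_gt0 V0.
  rewrite mulnC leq_pmul2r // mul2n -addnn expnD leq_pmul2l ?expn_gt0 //.
  by rewrite leqNgt ltn_expl.
exists (fun j i => X j i), (fun t => h (Z X t)); split=> [t|t j]; first by exists (Z X t).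
apply/idP/forallP => [jt i|miss].
  apply: hmiss (ZL X t) _ _; apply/imsetP; exists (j, i) => //.
  by rewrite inE.
apply: contraNT XP => jt; apply/bigcupP; exists (t, j) => //.
by rewrite !inE; apply/forallP => i; rewrite inE.
Qed.

(* The traces of the relation on a sample of [L] blocks are at least [2 ^ L] in
   number, since a trace remembers which blocks it misses; this exceeds the
   Sauer-Shelah bound.  The crude exponent [3] of [K] comes from taking [L] linear
   in [K], where a logarithm would do. *)
Lemma epsilon_net (d : nat) :
  exists c, forall (I V : finType) (Q : Type) (r : V -> Q -> bool)
      (Q0 : Q -> Prop) (K : nat),
    #|I| <= d -> 0 < K -> 0 < #|V| ->
    ~ (exists (x : I -> V) (y : {set I} -> Q), forall i s, r (x i) (y s) = (i \in s)) ->
    (forall q, Q0 q -> #|V| <= K * #|[set v | r v q]|) ->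
    exists2 E : {set V}, #|E| <= c * K ^ 3 &
      forall q, Q0 q -> exists2 v, v \in E & r v q.
Proof.
have [c cP] := net_exponent d; exists (2 * c ^ 2) => I V Q r Q0 [//|k] Id _ V0.
move=> noshatter big; apply: contrapT => nonet.
set L := c * k.+1.
(* The size allowed for a net is the number of positions in a whole sample, so the union of any
   blocks is small enough to fail as a net. *)
have Lm : L * (2 * L * k.+1) = 2 * c ^ 2 * k.+1 ^ 3.
  by rewrite /L !expnS !expn0; lia.
have [q0 q0P] : exists q, Q0 q.
  apply: contrapT => noq; apply: nonet; exists set0; first by rewrite cards0.
  by move=> q qQ; exfalso; apply: noq; exists q.
(* For [Z] too large to be refuted, the default [q0] keeps the witness in [Q0], so its set is still
   dense. *)
have /choice[h hP] : forall Z : {set V}, exists q, Q0 q /\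
    (#|Z| <= L * (2 * L * k.+1) -> forall v, v \in Z -> ~~ r v q).
  move=> Z; have [ZL|ZL] := leqP #|Z| (L * (2 * L * k.+1)); last by exists q0.
  apply: contrapT => allhit; apply: nonet; exists Z; first by rewrite -Lm.
  move=> q qQ; apply: contrapT => qZ; apply: allhit; exists q; split=> // _ v vZ.
  by apply/negP => rvq; apply: qZ; exists v.
have [||X [f [fh fX]]] := @exists_block_sample V Q r h k L V0.
- by move=> Z; apply/big; have [] := hP Z.
- by move=> Z ZL; have [_] := hP Z; apply.
set m := 2 * L * k.+1 in X fX.
pose S t := [set p : 'I_L * 'I_m | r (X p.1 p.2) (f t)].
have S_inj : injective S.
  move=> t t' tt'; apply/setP => j; rewrite !fX; apply: eq_forallb => i.
  by move/setP: tt' => /(_ (j, i)); rewrite !inE /= => ->.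
have [] := @exists_shattered _ (S @: setT) d.
  rewrite card_imset // -powersetT card_powerset cardsT card_prod !card_ord.
  by rewrite (_ : L * m = 2 * L ^ 2 * k.+1); [exact: cP | rewrite /m; lia].
move=> s /shattersP sh ds; apply: noshatter.
have Is : #|I| <= #|s| by apply: leq_trans Id (ltnW ds).
(* Since [#|I| <= d < #|s|], [I] embeds into the shattered set, which transports the shattering to
   [I]. *)
pose g (i : I) := enum_val (widen_ord Is (enum_rank i)).
have g_inj : injective g.
  by move=> i j /enum_val_inj/(congr1 val)/= /val_inj/enum_rank_inj.
have /choice[y yP] : forall a : {set I}, exists t, S t :&: s = g @: a.
  move=> a; have [|A /imsetP[t _ ->] <-] := sh (g @: a); last by exists t.
  by apply/fintype.subsetP => _ /imsetP[i _ ->]; apply: enum_valP.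
exists (fun i => X (g i).1 (g i).2), (f \o y) => i a.
rewrite -(mem_imset a i g_inj) -yP !inE.
by rewrite /g enum_valP andbT.
Qed.

End EpsilonNet.

(** * Finite product sets and Ruzsa's triangle inequality *)

Section SmallTripling.

Local Open Scope fset_scope.

Lemma card_fsetM (S T : choiceType) (X : {fset S}) (Y : {fset T}) :
  #|` X `*` Y| = (#|` X| * #|` Y|)%N.
Proof.
rewrite -(size_allpairs pair); apply: perm_size.
by apply: enum_imfset2 => -[? ?] [? ?] _ _ /= [-> ->].
Qed.

Definition fsmul (G : groupType) (X Y : {fset G}) : {fset G} :=
  [fset (x * y)%g | x in X, y in Y].

Definition fsinv (G : groupType) (X : {fset G}) : {fset G} :=
  [fset x^-1%g | x in X].

Lemma fsmulP (G : groupType) (X Y : {fset G}) (z : G) :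
  reflect (exists x y, [/\ x \in X, y \in Y & z = (x * y)%g]) (z \in fsmul X Y).
Proof.
apply: (iffP (imfset2P _ _ _ _ _)) => [[x xX [y yY ->]]|[x [y [xX yY ->]]]].
  by exists x, y.
by exists x => //; exists y.
Qed.

Lemma mem_fsmul (G : groupType) (X Y : {fset G}) (x y : G) :
  x \in X -> y \in Y -> (x * y)%g \in fsmul X Y.
Proof. by move=> xX yY; apply/fsmulP; exists x, y. Qed.

Lemma mem_fsinv (G : groupType) (X : {fset G}) (x : G) :
  (x \in fsinv X) = (x^-1%g \in X).
Proof.
apply/imfsetP/idP => /= [[y yX ->]|xX]; first by rewrite invgK.
by exists x^-1%g; rewrite ?invgK.
Qed.

Lemma fsinvK (G : groupType) (X : {fset G}) : fsinv (fsinv X) = X.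
Proof. by apply/fsetP => x; rewrite !mem_fsinv invgK. Qed.

Lemma card_fsinv (G : groupType) (X : {fset G}) : #|` fsinv X| = #|` X|.
Proof. by apply: card_imfset => x y /invg_inj. Qed.

Lemma fsmulA (G : groupType) (X Y Z : {fset G}) :
  fsmul X (fsmul Y Z) = fsmul (fsmul X Y) Z.
Proof.
apply/fsetP => w; apply/fsmulP/fsmulP.
  move=> [x [_ [xX /fsmulP[y [z [yY zZ ->]]] ->]]].
  by exists (x * y)%g, z; rewrite mulgA mem_fsmul.
move=> [_ [z [/fsmulP[x [y [xX yY ->]]] zZ ->]]].
by exists x, (y * z)%g; rewrite mulgA mem_fsmul.
Qed.

Lemma fsinvM (G : groupType) (X Y : {fset G}) :
  fsinv (fsmul X Y) = fsmul (fsinv Y) (fsinv X).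
Proof.
apply/fsetP => w; rewrite mem_fsinv; apply/fsmulP/fsmulP.
  move=> [x [y [xX yY wE]]]; exists y^-1%g, x^-1%g.
  by rewrite !mem_fsinv !invgK -invgM -wE invgK.
move=> [y [x [yY xX ->]]]; exists x^-1%g, y^-1%g.
by rewrite -!mem_fsinv invgM.
Qed.

Lemma fsmulUl (G : groupType) (X Y Z : {fset G}) :
  fsmul (X `|` Y) Z = fsmul X Z `|` fsmul Y Z.
Proof.
apply/fsetP => w; rewrite inE; apply/fsmulP/orP.
  move=> [x [z [+ zZ ->]]]; rewrite inE => /orP[xX|xY]; [left|right];
    exact: mem_fsmul.
by case=> /fsmulP[x [z [xX zZ ->]]]; exists x, z; rewrite inE xX ?orbT.
Qed.

Lemma fsmulUr (G : groupType) (X Y Z : {fset G}) :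
  fsmul X (Y `|` Z) = fsmul X Y `|` fsmul X Z.
Proof.
apply/fsetP => w; rewrite inE; apply/fsmulP/orP.
  move=> [x [z [xX + ->]]]; rewrite inE => /orP[zY|zZ]; [left|right];
    exact: mem_fsmul.
by case=> /fsmulP[x [z [xX zZ ->]]]; exists x, z; rewrite inE zZ ?orbT.
Qed.

Lemma card_fsmul_ger (G : groupType) (X Y : {fset G}) :
  X != fset0 -> (#|` Y| <= #|` fsmul X Y|)%N.
Proof.
case/fset0Pn=> x xX.
have <- : #|` [fset (x * y)%g | y in Y]| = #|` Y|.
  by apply: card_imfset => y z /mulgI.
by apply/fsubset_leq_card/fsubsetP => _ /imfsetP[/= y yY ->]; apply: mem_fsmul.
Qed.

(** Fix a factorization [w = x * z] of each [w] in [X Z], and send [(y, w)] to [(x * y^-1, y * z)].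
    The product of the two coordinates recovers [w], hence [z], hence [y], so the map is
    injective. *)
Lemma ruzsa_triangle (G : groupType) (X Y Z : {fset G}) :
  (#|` Y| * #|` fsmul X Z| <= #|` fsmul X (fsinv Y)| * #|` fsmul Y Z|)%N.
Proof.
have /choice[f fP] : forall w : G, exists p : G * G,
    w \in fsmul X Z -> [/\ p.1 \in X, p.2 \in Z & w = (p.1 * p.2)%g].
  move=> w; have [/fsmulP[x [z xzw]]|] := boolP (w \in fsmul X Z).
    by exists (x, z).
  by exists (1%g, 1%g).
rewrite -!card_fsetM.
pose g (p : G * G) := ((f p.2).1 * p.1^-1, p.1 * (f p.2).2)%g.
have <- : #|` [fset g p | p in Y `*` fsmul X Z]| = #|` Y `*` fsmul X Z|.
  apply: card_in_imfset.
  move=> [y w] [y' w']; rewrite !inE /= => /andP[_ wXZ] /andP[_ wXZ'] [e1 e2].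
  have [_ _ wE] := fP _ wXZ; have [_ _ wE'] := fP _ wXZ'.
  have ww' : w = w'.
    rewrite wE wE' -[(f w).1](mulgVK y) -[(f w').1](mulgVK y').
    by rewrite -[LHS]mulgA -[RHS]mulgA e1 e2.
  by move: e2; rewrite ww' => /mulIg ->.
apply/fsubset_leq_card/fsubsetP => x /imfsetP[/= [y w]].
rewrite in_fsetM => /andP[/= yY wXZ] ->; have [fX fZ _] := fP _ wXZ.
by rewrite inE /= !mem_fsmul // mem_fsinv invgK.
Qed.

(** The product [S S S] expands into eight triple products of [A] and its inverse. Each is bounded
    by Ruzsa's inequality or by inverting one already bounded; the alternating ones are the worst,
    with [k^3]. *)
Lemma card_signed_triples (G : groupType) (A : {fset G}) (S := A `|` fsinv A) :
  A != fset0 ->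
  (#|` fsmul S (fsmul S S)| * #|` A| ^ 2 <= 8 * #|` fsmul A (fsmul A A)| ^ 3)%N.
Proof.
move=> A0; set B := fsinv A in S *.
set a := #|` A|; set t := #|` fsmul A (fsmul A A)|.
have B0 : (#|` B| = a)%N by apply: card_fsinv.
have AB : fsinv B = A by apply: fsinvK.
have tAA : (#|` fsmul A A| <= t)%N by apply: card_fsmul_ger.
have le_at : (a <= t)%N by apply: leq_trans tAA; apply: card_fsmul_ger.
have tBB : (#|` fsmul B B| <= t)%N by rewrite -card_fsinv fsinvM AB.
(* [small i X] stands for [|X| <= k^(i+1) |A|], with [k = t / a]. *)
pose small (i : nat) (X : {fset G}) := (#|` X| * a ^ i <= t ^ i.+1)%N.
have smallV i X : small i (fsinv X) = small i X by rewrite /small card_fsinv.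
have smallW i j X : (i <= j)%N -> small i X -> small j X.
  move=> /subnKC <-; elim: (j - i)%N => [|n IHn Xi]; first by rewrite addn0.
  by rewrite addnS /small expnSr mulnA [(t ^ _)%N]expnSr leq_mul //; apply: IHn.
have small0 X : (#|` X| <= t)%N -> small 0 X by rewrite /small muln1.
(* Dividing by [|Y| = a] turns [k^(i+1) a] times [k^(j+1) a] into [k^(i+j+2) a], whence the level
   [(i + j).+1]. *)
have ruzsa i j X Y Z : #|` Y| = a ->
    small i (fsmul X (fsinv Y)) -> small j (fsmul Y Z) ->
    small (i + j).+1 (fsmul X Z).
  rewrite /small => Ya XY YZ; have := ruzsa_triangle X Y Z; rewrite Ya => XZ.
  rewrite (_ : (#|` fsmul X Z| * _ = a * #|` fsmul X Z| * (a ^ i * a ^ j))%N).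
    apply: leq_trans (leq_mul XZ (leqnn _)) _; rewrite mulnACA.
    by apply: leq_trans (leq_mul XY YZ) _; rewrite -expnD addSn addnS.
  by rewrite expnS expnD mulnCA mulnA.
have AAA : small 0 (fsmul A (fsmul A A)) by apply: small0.
have BBB : small 0 (fsmul B (fsmul B B)).
  by rewrite -smallV !fsinvM AB -fsmulA.
have AAB : small 1 (fsmul A (fsmul A B)).
  rewrite fsmulA; apply: (ruzsa 0 0 _ B) => //; first by rewrite AB -fsmulA.
  exact: small0.
have BAA : small 1 (fsmul B (fsmul A A)).
  by apply: (ruzsa 0 0 _ A) => //; apply: small0.
have ABB : small 1 (fsmul A (fsmul B B)).
  by rewrite -smallV !fsinvM AB -fsmulA.
have BBA : small 1 (fsmul B (fsmul B A)).
  by rewrite -smallV !fsinvM AB -fsmulA.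
have ABA : small 2 (fsmul A (fsmul B A)).
  rewrite fsmulA; apply: (ruzsa 1 0 _ A) => //; first by rewrite -fsmulA.
  exact: small0.
have BAB : small 2 (fsmul B (fsmul A B)).
  rewrite fsmulA; apply: (ruzsa 1 0 _ B) => //; first by rewrite AB -fsmulA.
  exact: small0.
have smallU m n (X Y : {fset G}) : (#|` X| * a ^ 2 <= m * t ^ 3)%N ->
    (#|` Y| * a ^ 2 <= n * t ^ 3)%N ->
    (#|` X `|` Y| * a ^ 2 <= (m + n) * t ^ 3)%N.
  move=> Xm Yn; rewrite mulnDl; apply: leq_trans (leq_add Xm Yn).
  by rewrite -mulnDl leq_mul // leq_card_fsetU.
have small2 i X : (i <= 2)%N -> small i X -> (#|` X| * a ^ 2 <= 1 * t ^ 3)%N.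
  by move=> i2 /(smallW _ _ _ i2); rewrite mul1n.
rewrite /S !(fsmulUl, fsmulUr).
apply: (smallU 4 4); apply: (smallU 2 2); apply: (smallU 1 1);
  by [apply: (small2 0) | apply: (small2 1) | apply: (small2 2)].
Qed.


End SmallTripling.

(** * Nets for the translates of a NIP set *)

Section Covering.

Local Open Scope fset_scope.

(** The net theorem is run on [U] as a finite type. The constant is chosen before the index type
    [I], so it can serve several index types. *)
Lemma epsilon_net_fset (d : nat) :
  exists c, forall (I : finType) (T : choiceType) (Q : Type) (U : {fset T})
      (r : T -> Q -> Prop) (Q0 : Q -> Prop) (K : nat),
    #|I| <= d -> 0 < K -> U != fset0 ->
    ~ (exists (x : I -> T) (y : {set I} -> Q),
         forall i (s : {set I}), r (x i) (y s) <-> i \in s) ->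
    (forall q, Q0 q -> exists S : {fset T},
       [/\ S `<=` U, forall v, v \in S -> r v q & #|` U| <= K * #|` S|]) ->
    exists E : {fset T}, [/\ E `<=` U, #|` E| <= c * K ^ 3 &
      forall q, Q0 q -> exists2 v, v \in E & r v q].
Proof.
have [c cP] := epsilon_net d; exists c => I T Q U r Q0 K Id K0 U0 noshatter big.
have [||q qQ|E Ec Enet] := cP I U Q (fun v q => `[< r (val v) q >]) Q0 K Id K0.
- by rewrite -cardfE cardfs_gt0.
- case=> x [y xyP]; apply: noshatter; exists (val \o x), y => i s /=.
  by rewrite -xyP; split=> [/asboolP|/asboolP].
- have [S [SU Sr US]] := big q qQ; rewrite -cardfE; apply: leq_trans US _.
  rewrite leq_mul2l -(card_fsub SU); apply/orP; right; apply: subset_leq_card.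
  apply/fintype.subsetP => v; rewrite in_fsub inE => vS.
  by apply/asboolP; apply: Sr.
exists [fset val v | v in E]; split.
- by apply/fsubsetP => _ /imfsetP[/= v _ ->]; apply: valP.
- apply: leq_trans Ec; by rewrite (card_imfset _ _ val_inj) [leqRHS]cardE leqnn.
- move=> q /Enet[v vE /asboolP rvq]; exists (val v) => //.
  by apply/imfsetP; exists v.
Qed.

Lemma NIP_covering (d : nat) :
  exists c, forall (G : groupType) (A : {fset G}) (S := A `|` fsinv A)
      (U := fsmul S (fsmul S S)) (K : nat),
    NIP d [set` A]%classic -> A != fset0 -> #|` U| <= K * #|` A| ->
    exists E F : {fset G}, [/\ E `<=` U, F `<=` U,
      #|` E| <= c * K ^ 3, #|` F| <= c * K ^ 3 &
      forall g, g \in fsmul S S `|` [fset 1%g] ->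
        g \in fsmul E A /\ g \in fsmul A F].
Proof.
(* The bound [2 ^ d] covers both index types used below, [{set 'I_d}] for [E] and ['I_d] for [F]. *)
have [c cP] := epsilon_net_fset (2 ^ d).
exists c => G A S U K nip A0 UK.
have [b bA] := fset0Pn _ A0.
have SA x : x \in A -> x \in S by rewrite inE => ->.
have SV x : x \in A -> (x^-1)%g \in S by rewrite inE mem_fsinv invgK orbC => ->.
have U0 : U != fset0 by apply/fset0Pn; exists (b * (b * b))%g; rewrite !mem_fsmul ?SA.
have K0 : 0 < K.
  rewrite lt0n; apply: contraTneq UK => ->.
  by rewrite mul0n -ltnNge cardfs_gt0.
have gAV g x : g \in fsmul S S `|` [fset 1%g] -> x \in A -> (g * x^-1)%g \in U.
  rewrite in_fsetU in_fset1 => /orP[/fsmulP[y [z [yS zS ->]]]|/eqP ->] xA.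
    by rewrite -mulgA !mem_fsmul ?SV.
  (* For [g = 1], writing [x^-1] as [x^-1 * (x * x^-1)] makes it a triple product. *)
  by rewrite mul1g -[(x^-1)%g]mul1g -(mulVg x) -mulgA !mem_fsmul ?SV ?SA.
have AVg g x : g \in fsmul S S `|` [fset 1%g] -> x \in A -> (x^-1 * g)%g \in U.
  rewrite in_fsetU in_fset1 => /orP[/fsmulP[y [z [yS zS ->]]]|/eqP ->] xA.
    by rewrite !mem_fsmul ?SV.
  by rewrite mulg1 -[(x^-1)%g]mul1g -(mulVg x) -mulgA !mem_fsmul ?SV ?SA.
have [|||E [EU Ec Enet]] := cP {set 'I_d} G G U
  (fun u g => (u^-1 * g)%g \in A) (fun g => g \in fsmul S S `|` [fset 1%g]) K _ K0 U0.
- by rewrite -cardsT -powersetT card_powerset cardsT card_ord.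
(* [u^-1 * g] has the points on the [y]-side of [NIP], so the dual VC-dimension is
   needed here, whence the index set [{set 'I_d}]. *)
- case=> x [y xyP]; apply: nip.
  (* The point for [i] is [y] at the family of all [s] containing [i], so membership of [s] in that
     family reads [i \in s]. *)
  exists (fun i => y [set s : {set 'I_d} | i \in s]%SET), (fun s => (x s)^-1%g).
  by move=> i s /=; rewrite xyP inE.
- move=> g gS; exists [fset (g * x^-1)%g | x in A]; split.
  + by apply/fsubsetP => _ /imfsetP[/= x xA ->]; apply: gAV.
  + by move=> _ /imfsetP[/= x xA ->]; rewrite invgM invgK mulgVK.
  + by rewrite card_imfset // => x y /mulgI/invg_inj.
have [|||F [FU Fc Fnet]] := cP 'I_d G G U
  (fun u g => (g * u^-1)%g \in A) (fun g => g \in fsmul S S `|` [fset 1%g]) K _ K0 U0.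
- by rewrite card_ord ltnW // ltn_expl.
- case=> x [y xyP]; apply: nip; exists (fun i => (x i)^-1%g), y.
  by move=> i s /=; rewrite xyP.
- move=> g gS; exists [fset (x^-1 * g)%g | x in A]; split.
  + by apply/fsubsetP => _ /imfsetP[/= x xA ->]; apply: AVg.
  + by move=> _ /imfsetP[/= x xA ->]; rewrite invgM invgK mulVKg.
  + by rewrite card_imfset // => x y /mulIg/invg_inj.
exists E, F; split=> // g gS; split.
  by have [v vE vg] := Enet g gS; apply/fsmulP; exists v, (v^-1 * g)%g; rewrite mulVKg.
by have [v vF vg] := Fnet g gS; apply/fsmulP; exists (g * v^-1)%g, v; rewrite mulgVK.
Qed.

End Covering.

(** * Return to classical sets and real constants *)

Local Open Scope classical_set_scope.
Local Open Scope ring_scope.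

Lemma setmulE (G : groupType) (X Y : {fset G}) :
  setmul [set` X] [set` Y] = [set` fsmul X Y].
Proof.
apply/seteqP; split=> [_ [x xX [y yY <-]]|z /= /fsmulP[x [y [xX yY ->]]]].
  exact: mem_fsmul.
by exists x => //; exists y.
Qed.

Lemma setinvE (G : groupType) (X : {fset G}) : setinv [set` X] = [set` fsinv X].
Proof.
apply/seteqP; split=> [_ [x xX <-]|x /=]; rewrite /= mem_fsinv ?invgK //.
by move=> xX; exists x^-1%g; rewrite ?invgK.
Qed.

(** Products of two elements of [A] or its inverse lie in [E A]. Products with a factor 1 stay in
    [setpm A 1], and the extra translate by 1 covers them; hence the successor. *)
Lemma approximate_group_cover (G : groupType) (A : set G) (E : {fset G}) :
  setpm A 2 `<=` setmul [set` E] A ->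
  approximate_group #|` E|.+1 (setpm A 1).
Proof.
move=> AE; split; first by right.
  apply/seteqP; split=> [x [[xA|[a aA <-]]|->]|_ [x [[xA|[a aA <-]]|->] <-]].
  - by exists x^-1%g; rewrite ?invgK //; left; right; exists x.
  - by exists a => //; left; left.
  - by exists 1%g; rewrite ?invg1 //; right.
  - by left; right; exists x.
  - by rewrite invgK; left; left.
  - by rewrite invg1; right.
exists (fun i => nth 1%g (1%g :: E) i) => _ [x xA [y yA <-]].
have cover1 z : setpm A 1 z -> (\bigcup_(i in [set: 'I_(#|` E|.+1)])
    setmul [set nth 1%g (1%g :: E) i] (setpm A 1)) z.
  by move=> zA; exists ord0 => //; exists 1%g => //; exists z; rewrite ?mul1g.
case: yA => [yS|->]; last by rewrite mulg1; apply: cover1.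
case: xA => [xS|->]; last by rewrite mul1g; apply: cover1; left.
have [|e eE [a aA <-]] := AE (x * y)%g; first by left; exists x => //; exists y.
have iE : (index e (1%g :: E) < size (1%g :: E))%N.
  by rewrite index_mem inE [_ \in _]eE orbT.
exists (Ordinal iE) => //; exists e; last by exists a => //; left; left.
by rewrite /= nth_index // inE [_ \in _]eE orbT.
Qed.

Theorem theorem3p20 (R : realType) :
  exists c0 : R, 0 < c0 /\
    forall d : nat, (1 <= d)%N ->
      exists C : R, 0 < C /\
        forall (k : R), 1 <= k ->
        forall (G : groupType) (A : set G),
          NIP d A -> has_tripling k A ->
          (exists E F : set G,
            [/\ E `<=` setpm A 3, F `<=` setpm A 3,
                finite_set E /\ (set_card E)%:R <= C * k `^ c0,
                finite_set F /\ (set_card F)%:R <= C * k `^ c0 &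
                setpm A 2 `<=` setmul E A `&` setmul A F]) /\
          (exists K : nat,
            K%:R <= C * k `^ c0 /\ approximate_group K (setpm A 1)).
Proof.
(* The density parameter [K] is of order [k^3], and the nets have size cubic in [K]. *)
exists 9%:R; split=> [|d _]; first by rewrite ltr0n.
have [c cP] := NIP_covering d.
(* Here [729 = 9^3] comes from [K <= 8 * k^3 + 1 <= 9 * k^3], which uses [k >= 1]. The summand 1
   pays for the extra translate and keeps the constant positive if [c = 0]. *)
exists (729 * c%:R + 1); split=> [|k k1 G A nipA [Aneq0 Afin]].
  by rewrite ltr_wpDl // mulr_ge0.
have k0 : 0 <= k by apply: le_trans k1.
rewrite powR_mulrn //.
pose B := fset_set A; have AB : A = [set` B] by rewrite fset_setK.
have B0 : (B != fset0)%fset.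
  by have [a aA] := Aneq0; apply/fset0Pn; exists a; rewrite in_fset_set ?inE.
pose S := (B `|` fsinv B)%fset.
have SE : A `|` setinv A = [set` S] by rewrite AB setinvE -set_fsetU.
rewrite [set_card A]/set_card -/B {1}AB /setexp /= !setmulE.
rewrite [set_card _]/set_card set_fsetK => tripling.
pose U := fsmul S (fsmul S S).
(* The successor of the truncation is a natural number above [8 * k^3]. *)
pose K := (Num.truncn (8 * k ^+ 3)).+1.
have [||E [F [EU FU Ec Fc EF]]] := cP G B K _ B0.
- by rewrite -AB.
- have a0 : (0 < #|` B|%:R :> R) by rewrite ltr0n cardfs_gt0.
  have := card_signed_triples B0; rewrite -/S -/U.
  rewrite -(ler_nat R) natrM natrX [(8 * _)%:R]natrM natrX => Ut.
  rewrite -(ler_nat R) natrM.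
  apply: (@le_trans _ _ (8 * k ^+ 3 * #|` B|%:R)); last first.
    by rewrite ler_pM2r // ltW // truncnS_gt.
  have a2 : 0 < #|` B|%:R ^+ 2 :> R by rewrite exprn_gt0.
  rewrite -(ler_pM2r a2); apply: le_trans Ut _.
  rewrite (_ : 8 * k ^+ 3 * _ * _ = 8 * (k * #|` B|%:R) ^+ 3); last by ring.
  rewrite ler_pM2l //.
  by rewrite lerXn2r ?nnegrE ?mulr_ge0.
have bound : (c * K ^ 3)%:R + 1 <= (729 * c%:R + 1) * k ^+ 9.
  have k3 : 1 <= k ^+ 3 by rewrite exprn_ege1.
  have Kk : K%:R <= 9 * k ^+ 3.
    have : K%:R <= 8 * k ^+ 3 + 1.
      by rewrite /K -natr1 lerD2r truncn_le // mulr_ge0 // exprn_ge0.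
    by lra.
  rewrite natrM natrX mulrDl mul1r lerD ?exprn_ege1 //.
  rewrite [729 * _]mulrC -mulrA ler_wpM2l //.
  rewrite (_ : 729 * k ^+ 9 = (9 * k ^+ 3) ^+ 3); last by ring.
  by rewrite lerXn2r ?nnegrE ?mulr_ge0 ?exprn_ge0.
have bnd n : (n <= c * K ^ 3)%N -> n%:R + 1 <= (729 * c%:R + 1) * k ^+ 9.
  by move=> nc; apply: le_trans bound; rewrite lerD2r ler_nat.
have cover : setpm A 2 `<=` setmul [set` E] A `&` setmul A [set` F].
  move=> g; rewrite /setpm /setexp SE /= setmulE => gS; rewrite AB !setmulE.
  by apply: EF; rewrite in_fsetU in_fset1; case: gS => [->//|->]; rewrite eqxx orbT.
split; last first.
  exists #|` E|.+1; split; first by rewrite -natr1 bnd.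
  by apply: approximate_group_cover => g /cover[].
have U3 (X : {fset G}) : (X `<=` U)%fset -> [set` X] `<=` setpm A 3.
  move=> /fsubsetP XU x /= /XU xU; left.
  by rewrite /setexp SE /= !setmulE.
exists [set` E], [set` F]; rewrite /set_card !set_fsetK; split=> //; try exact: U3.
- by split; [exact: finite_fset | apply: le_trans (bnd _ Ec); rewrite lerDl].
- by split; [exact: finite_fset | apply: le_trans (bnd _ Fc); rewrite lerDl].
Qed.
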